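(* Let $\Gamma$ be a finite connected quiver and $k$ a field. Then the following statements are equivalent: (i) all $k\Gamma$-modules are (positively) graded; (ii) all $P(\Gamma)$-Systems in $P(\Gamma)\text{-}\mathcal{TOP}^{o}$ are (positively) graded. That is: all $k\Gamma$-modules are graded if and only if all $P(\Gamma)$-Systems in $P(\Gamma)\text{-}\mathcal{TOP}^{o}$ are graded; and all $k\Gamma$-modules are positively graded if and only if all $P(\Gamma)$-Systems in $P(\Gamma)\text{-}\mathcal{TOP}^{o}$ are positively graded.
   Context: A quiver $\Gamma=(\Gamma_0,\Gamma_1)$ is an oriented graph with vertex set $\Gamma_0$ and arrow set $\Gamma_1$; it is finite if both sets are finite, and connected if its underlying unoriented graph is connected. $P(\Gamma)$ is the semigroup with zero consisting of $0$ and all paths of $\Gamma$ (including the trivial paths $e_i$, $i\in\Gamma_0$); the product $\rho\rho'$ of paths is their concatenation (first $\rho'$, then $\rho$) if the source of $\rho$ equals the target of $\rho'$, and $0$ otherwise; $0$ is absorbing. The path algebra $k\Gamma$ is the $k$-algebra with basis the paths of $\Gamma$ and this multiplication. Modules are left modules. A $P(\Gamma)$-System is a nonempty topological space $M$ with an action $(\rho,m)\mapsto\rho m$ of $P(\Gamma)$ such that $(\rho\rho')m=\rho(\rho'm)$ and each map $m\mapsto\rho m$ is continuous. It belongs to $P(\Gamma)\text{-}\mathcal{TOP}^{o}$ if: (a) $P(\Gamma)M=M$; (b) there is a unique $\theta_M\in M$ such that $\{\theta_M\}$ is a connected component of $M$ which is an isolated point and $0m=\theta_M$ for all $m\in M$;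 (c) if $e_im\neq\theta_M$ then $\alpha m\neq\theta_M$ for every arrow $\alpha$ starting at $i$. $P(\Gamma)_{(i)}$ denotes the set consisting of $0$ and all paths of length $i$ (and $\{0\}$ for $i<0$). An object $M$ of $P(\Gamma)\text{-}\mathcal{TOP}^{o}$ is graded if there is a family of nonempty subsets $\{M_{(i)}\}_{i\in\mathbb Z}$ with $M=\bigcup_iM_{(i)}$, $P(\Gamma)_{(i)}M_{(j)}\subseteq M_{(i+j)}$, and $M_{(i)}\cap M_{(j)}=\{\theta_M\}$ for $i\ne j$; it is positively graded if the same holds with the index set $\mathbb Z_{\geq0}$. $(k\Gamma)_{(i)}$ denotes the span of the paths of length $i$. A $k\Gamma$-module $M$ is graded if it admits a decomposition $M=\bigoplus_{i\in\mathbb Z}M_{(i)}$ into $k$-subspaces with $(k\Gamma)_{(i)}M_{(j)}\subseteq M_{(i+j)}$; it is positively graded if it admits such a decomposition indexed by $\mathbb Z_{\ge0}$. *)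

(* Defs.v *)
(* MathComp and MathComp-Analysis *)
From HB Require Import structures.
From mathcomp Require Import all_boot all_order all_algebra finmap monalg.
From mathcomp Require Import all_classical topology.

Set Implicit Arguments.
Unset Strict Implicit.
Unset Printing Implicit Defensive.

Import Order.TTheory GRing.Theory Num.Theory.
Local Open Scope classical_set_scope.
Local Open Scope ring_scope.

Record finQuiver := FinQuiver {
  vertex : finType;
  arrow : finType;
  asrc : arrow -> vertex;
  atgt : arrow -> vertex
}.

Section Connected.
Variable G : finQuiver.

Definition adjacent : rel (vertex G) := fun i j =>
  [exists a : arrow G, ((asrc a == i) && (atgt a == j))
                    || ((asrc a == j) && (atgt a == i))].

(* The empty quiver is not excluded. *)
Definition connected_quiver : Prop := forall i j, connect adjacent i j.

End Connected.

Section Paths.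
Variable G : finQuiver.
Implicit Types (i j : vertex G) (a : arrow G) (s t : seq (arrow G)).

Fixpoint composable i s : bool :=
  if s is a :: s' then (asrc a == i) && composable (atgt a) s' else true.

Definition chain_end i s : vertex G := last i (map (@atgt G) s).

(* A path is its source together with its arrows listed in the order in which
   they are traversed, i.e. from right to left in the written product. *)
Record qpath := QPath {
  qpath_val : vertex G * seq (arrow G);
  _ : composable qpath_val.1 qpath_val.2
}.

HB.instance Definition _ := [isSub for qpath_val].
HB.instance Definition _ := [Choice of qpath by <:].

Definition psrc (p : qpath) : vertex G := (val p).1.
Definition parrows (p : qpath) : seq (arrow G) := (val p).2.
Definition ptgt (p : qpath) : vertex G := chain_end (psrc p) (parrows p).
Definition plen (p : qpath) : nat := size (parrows p).

Definition trivial_path i : qpath := @QPath (i, [::]) isT.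

Lemma arrow_path_subproof a : composable (asrc a) [:: a].
Proof. by rewrite /= eqxx. Qed.

Definition arrow_path a : qpath :=
  @QPath (asrc a, [:: a]) (arrow_path_subproof a).

Lemma composable_cat i s t :
  composable i (s ++ t) = composable i s && composable (chain_end i s) t.
Proof.
by elim: s i => [|a s IHs] i //=; rewrite IHs andbA.
Qed.

Lemma chain_end_cat i s t :
  chain_end i (s ++ t) = chain_end (chain_end i s) t.
Proof. by rewrite /chain_end map_cat last_cat. Qed.

Lemma pcat_subproof (p q : qpath) : psrc p = ptgt q ->
  composable (psrc q) (parrows q ++ parrows p).
Proof.
move=> e; rewrite composable_cat (valP q) -/(ptgt q) -e.
exact: (valP p).
Qed.

(* first q, then p *)
Definition pcat (p q : qpath) (e : psrc p = ptgt q) : qpath :=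
  @QPath (psrc q, parrows q ++ parrows p) (pcat_subproof e).

(* P(G), with None as the zero *)
Definition pathSG := option qpath.

Definition psg_mul (r r' : pathSG) : pathSG :=
  if (r, r') is (Some p, Some q)
  then if psrc p =P ptgt q is ReflectT e then Some (pcat e) else None
  else None.

Lemma psg_mul_neq p q : psrc p != ptgt q -> psg_mul (Some p) (Some q) = None.
Proof. by rewrite /psg_mul; case: eqP. Qed.

Lemma psg_mul_eq p q (e : psrc p = ptgt q) :
  psg_mul (Some p) (Some q) = Some (pcat e).
Proof.
by rewrite /psg_mul; case: eqP => // e'; congr Some; apply: val_inj.
Qed.

Lemma ptgt_pcat p q (e : psrc p = ptgt q) : ptgt (pcat e) = ptgt p.
Proof. by rewrite /ptgt /= /psrc /parrows /= chain_end_cat -/(ptgt q) -e. Qed.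

Lemma psg_mulA : associative psg_mul.
Proof.
move=> [p|] [q|] [r|] //; last by case: (psg_mul (Some p) (Some q)).
have [eqr|nqr] := eqVneq (psrc q) (ptgt r); last first.
  rewrite (psg_mul_neq nqr).
  have [epq|npq] := eqVneq (psrc p) (ptgt q); last by rewrite (psg_mul_neq npq).
  by rewrite (psg_mul_eq epq) psg_mul_neq.
rewrite (psg_mul_eq eqr).
have [epq|npq] := eqVneq (psrc p) (ptgt q); last first.
  by rewrite (psg_mul_neq npq) psg_mul_neq ?ptgt_pcat.
rewrite (psg_mul_eq epq).
have e1 : psrc p = ptgt (pcat eqr) by rewrite ptgt_pcat.
have e2 : psrc (pcat epq) = ptgt r by [].
rewrite (psg_mul_eq e1) (psg_mul_eq e2); congr Some; apply: val_inj => /=.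
by rewrite /parrows /= catA.
Qed.

HB.instance Definition _ := Choice.on pathSG.
HB.instance Definition _ := isSemigroup.Build pathSG psg_mulA.

Definition psg_zero : pathSG := None.

Lemma psg_mul0g (r : pathSG) : (psg_zero * r = psg_zero)%g.
Proof. by []. Qed.

Lemma psg_mulg0 (r : pathSG) : (r * psg_zero = psg_zero)%g.
Proof. by case: r. Qed.

Definition psg_deg (n : int) : set pathSG :=
  [set r | if r is Some p then (plen p)%:Z = n else True].

End Paths.

Section Bilinear.
Variables (k : fieldType) (V : lmodType k) (T : Type) (b : T -> V).
Variable m : V -> V -> V.

Hypothesis b_ind : forall P : V -> Prop,
  P 0 -> (forall x y, P x -> P y -> P (x + y)) ->
  (forall c x, P x -> P (c *: x)) -> (forall p, P (b p)) -> forall x, P x.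
Hypotheses (mDl : left_distributive m +%R) (mDr : right_distributive m +%R).
Hypotheses (m0l : left_zero 0 m) (m0r : right_zero 0 m).
Hypothesis mZl : forall c x y, c *: m x y = m (c *: x) y.
Hypothesis mZr : forall c x y, c *: m x y = m x (c *: y).

Lemma bilinear_assoc :
  (forall p q r, m (b p) (m (b q) (b r)) = m (m (b p) (b q)) (b r)) ->
  associative m.
Proof.
move=> bA x y z; move: x; apply: b_ind => [|x x' Hx Hx'|c x Hx|p].
- by rewrite !m0l.
- by rewrite !mDl Hx Hx'.
- by rewrite -!mZl Hx.
move: y; apply: b_ind => [|y y' Hy Hy'|c y Hy|q].
- by rewrite m0r !m0l m0r.
- by rewrite mDr !mDl mDr Hy Hy'.
- by rewrite -mZr -!mZl -mZr Hy.
move: z; apply: b_ind => [|z z' Hz Hz'|c z Hz|r].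
- by rewrite !m0r.
- by rewrite !mDr Hz Hz'.
- by rewrite -!mZr Hz.
exact: bA.
Qed.

Lemma bilinear_left_id u : (forall p, m u (b p) = b p) -> left_id u m.
Proof.
move=> H; apply: b_ind => [|x y Hx Hy|c x Hx|p]; last exact: H.
- exact: m0r.
- by rewrite mDr Hx Hy.
- by rewrite -mZr Hx.
Qed.

Lemma bilinear_right_id u : (forall p, m (b p) u = b p) -> right_id u m.
Proof.
move=> H; apply: b_ind => [|x y Hx Hy|c x Hx|p]; last exact: H.
- exact: m0l.
- by rewrite mDl Hx Hy.
- by rewrite -mZl Hx.
Qed.

End Bilinear.

Section PathAlgebra.
Variables (k : fieldType) (G : finQuiver).

(* Finitely supported functions on the paths, with basis << p >>. *)
Definition pathAlg := {malg k[qpath G]}.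
HB.instance Definition _ := GRing.Lmodule.on pathAlg.

Implicit Types (x y z : pathAlg) (p q : qpath G).

Definition pbasis p : pathAlg := << p >>.

Definition psg_embed (r : pathSG G) : pathAlg := oapp pbasis 0 r.

Definition pa_mul x y : pathAlg :=
  \sum_(p <- msupp x) \sum_(q <- msupp y)
    (x@_p * y@_q) *: psg_embed ((Some p : pathSG G) * Some q)%g.

Definition pa_one : pathAlg := \sum_(i : vertex G) pbasis (trivial_path i).

Lemma pa_mulw (d1 d2 : {fset qpath G}) x y :
  (msupp x `<=` d1)%fset -> (msupp y `<=` d2)%fset ->
  pa_mul x y = \sum_(p <- d1) \sum_(q <- d2)
    (x@_p * y@_q) *: psg_embed ((Some p : pathSG G) * Some q)%g.
Proof.
move=> le1 le2; rewrite /pa_mul (big_fset_incl _ le1) /=.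
  apply/eq_bigr=> p _; apply/big_fset_incl => // q _ /mcoeff_outdom ->.
  by rewrite mulr0 scale0r.
move=> p _ /mcoeff_outdom xp.
by rewrite big1 // => q _; rewrite xp mul0r scale0r.
Qed.

Lemma pa_mulDl : left_distributive pa_mul +%R.
Proof.
move=> x y z.
rewrite (pa_mulw (msuppD_le x y) (fsubset_refl _)).
rewrite (pa_mulw (fsubsetUl (msupp x) (msupp y)) (fsubset_refl _)).
rewrite (pa_mulw (fsubsetUr (msupp x) (msupp y)) (fsubset_refl _)).
rewrite -big_split /=; apply/eq_bigr => p _.
rewrite -big_split /=; apply/eq_bigr => q _.
by rewrite mcoeffD mulrDl scalerDl.
Qed.

Lemma pa_mulDr : right_distributive pa_mul +%R.
Proof.
move=> x y z.
rewrite (pa_mulw (fsubset_refl _) (msuppD_le y z)).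
rewrite (pa_mulw (fsubset_refl _) (fsubsetUl (msupp y) (msupp z))).
rewrite (pa_mulw (fsubset_refl _) (fsubsetUr (msupp y) (msupp z))).
rewrite -big_split /=; apply/eq_bigr => p _.
rewrite -big_split /=; apply/eq_bigr => q _.
by rewrite mcoeffD mulrDr scalerDl.
Qed.

Lemma pa_mul0l : left_zero 0 pa_mul.
Proof. by move=> x; rewrite /pa_mul msupp0 big_seq_fset0. Qed.

Lemma pa_mul0r : right_zero 0 pa_mul.
Proof.
by move=> x; rewrite /pa_mul big1 // => p _; rewrite msupp0 big_seq_fset0.
Qed.

Lemma pa_scalerAl (c : k) x y : c *: pa_mul x y = pa_mul (c *: x) y.
Proof.
rewrite (pa_mulw (msuppZ_le c x) (fsubset_refl _)) scaler_sumr.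
apply/eq_bigr => p _; rewrite scaler_sumr; apply/eq_bigr => q _.
by rewrite mcoeffZ scalerA mulrA.
Qed.

Lemma pa_scalerAr (c : k) x y : c *: pa_mul x y = pa_mul x (c *: y).
Proof.
rewrite (pa_mulw (fsubset_refl _) (msuppZ_le c y)) scaler_sumr.
apply/eq_bigr => p _; rewrite scaler_sumr; apply/eq_bigr => q _.
by rewrite mcoeffZ scalerA mulrCA.
Qed.

Lemma pa_mul_basis p q :
  pa_mul (pbasis p) (pbasis q) = psg_embed ((Some p : pathSG G) * Some q)%g.
Proof.
rewrite (pa_mulw msuppU_le msuppU_le) !big_seq_fset1 !mcoeffUU.
by rewrite mulr1 scale1r.
Qed.

Lemma pa_mul_embed (r r' : pathSG G) :
  pa_mul (psg_embed r) (psg_embed r') = psg_embed (r * r')%g.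
Proof.
case: r r' => [p|] [q|]; rewrite /= ?pa_mul0l ?pa_mul0r //.
exact: pa_mul_basis.
Qed.

Lemma pbasis_sum x : x = \sum_(p <- msupp x) x@_p *: pbasis p.
Proof.
rewrite {1}(monalgE x); apply/eq_bigr => p _; apply/malgP => q.
by rewrite mcoeffZ [LHS]mcoeffU [X in _ * X]mcoeffU mulrnAr mulr1.
Qed.

Lemma pbasis_ind (P : pathAlg -> Prop) :
  P 0 -> (forall x y, P x -> P y -> P (x + y)) ->
  (forall c x, P x -> P (c *: x)) -> (forall p, P (pbasis p)) ->
  forall x, P x.
Proof.
move=> P0 PD PZ Pb x; rewrite (pbasis_sum x).
by elim/big_ind: _ => // p _; apply: PZ.
Qed.

Lemma pa_mulA : associative pa_mul.
Proof.
apply: (bilinear_assoc pbasis_ind pa_mulDl pa_mulDr pa_mul0l pa_mul0r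
  pa_scalerAl pa_scalerAr) => p q r.
have := congr1 psg_embed
  (mulgA (Some p : pathSG G) (Some q : pathSG G) (Some r : pathSG G)).
by rewrite -!pa_mul_embed.
Qed.

Lemma pa_mul_suml (I : finType) (F : I -> pathAlg) y :
  pa_mul (\sum_i F i) y = \sum_i pa_mul (F i) y.
Proof.
exact: (big_morph (pa_mul^~ y) (fun a b => pa_mulDl a b y) (pa_mul0l y)).
Qed.

Lemma pa_mul_sumr (I : finType) (F : I -> pathAlg) x :
  pa_mul x (\sum_i F i) = \sum_i pa_mul x (F i).
Proof. exact: (big_morph (pa_mul x) (pa_mulDr x) (pa_mul0r x)). Qed.

Lemma pa_mul1l : left_id pa_one pa_mul.
Proof.
apply: (bilinear_left_id pbasis_ind pa_mulDr pa_mul0r pa_scalerAr) => p.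
rewrite pa_mul_suml (bigD1 (ptgt p)) //= big1 => [|i ni]; last first.
  by rewrite pa_mul_basis [X in psg_embed X]psg_mul_neq.
have e : psrc (trivial_path (ptgt p)) = ptgt p by [].
rewrite addr0 pa_mul_basis [X in psg_embed X](psg_mul_eq e) /=.
congr pbasis; apply: val_inj => /=.
by rewrite cats0 /psrc /parrows /=; case: (qpath_val p).
Qed.

Lemma pa_mul1r : right_id pa_one pa_mul.
Proof.
apply: (bilinear_right_id pbasis_ind pa_mulDl pa_mul0l pa_scalerAl) => p.
rewrite pa_mul_sumr (bigD1 (psrc p)) //= big1 => [|i ni]; last first.
  by rewrite pa_mul_basis [X in psg_embed X]psg_mul_neq // eq_sym.
have e : psrc p = ptgt (trivial_path (psrc p)) by [].
rewrite addr0 pa_mul_basis [X in psg_embed X](psg_mul_eq e) /=.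
congr pbasis; apply: val_inj => /=.
by rewrite /psrc /parrows /=; case: (qpath_val p).
Qed.

(* Only a pzRingType: the path algebra of the empty quiver is the zero ring. *)
HB.instance Definition _ := GRing.Zmodule_isPzRing.Build pathAlg
  pa_mulA pa_mul1l pa_mul1r pa_mulDl pa_mulDr.

Definition pathAlg_deg (n : int) : set pathAlg :=
  [set x | exists (s : seq (qpath G)) (c : qpath G -> k),
     (forall p, p \in s -> (plen p)%:Z = n)
     /\ x = \sum_(p <- s) c p *: pbasis p].

End PathAlgebra.

Definition nonneg_int : set int := [set n | 0 <= n].

Section GradedModules.
Variables (k : fieldType) (G : finQuiver) (M : lmodType (pathAlg k G)).

(* k acts on M through the scalars c *: 1 of the path algebra. *)
Definition k_subspace (S : set M) : Prop :=
  [/\ S 0, forall u v, S u -> S v -> S (u + v)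
    & forall (c : k) u, S u -> S ((c *: (1 : pathAlg k G)) *: u)].

Definition direct_sum_decomposition (D : set int) (M_ : int -> set M) : Prop :=
  (forall m : M, exists (s : {fset int}) (f : int -> M),
     (forall i, i \in s -> D i /\ M_ i (f i)) /\ m = \sum_(i <- s) f i)
  /\ (forall (s : {fset int}) (f : int -> M),
     (forall i, i \in s -> D i /\ M_ i (f i)) -> \sum_(i <- s) f i = 0 ->
     forall i, i \in s -> f i = 0).

(* Only the members of M_ with index in D matter. *)
Definition module_graded_over (D : set int) : Prop :=
  exists M_ : int -> set M,
  [/\ forall i, D i -> k_subspace (M_ i),
      direct_sum_decomposition D M_
    & forall i j, D i -> D j -> forall (x : pathAlg k G) m,
        pathAlg_deg i x -> M_ j m -> M_ (i + j) (x *: m)].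

Definition module_graded : Prop := module_graded_over [set: int].
Definition module_positively_graded : Prop := module_graded_over nonneg_int.

End GradedModules.

Record pathSystem (G : finQuiver) := PathSystem {
  psys_carrier :> topologicalType;
  psys_act : pathSG G -> psys_carrier -> psys_carrier;
  psys_nonempty : [set: psys_carrier] !=set0;
  psys_actM : forall r r' m,
    psys_act (r * r')%g m = psys_act r (psys_act r' m);
  psys_act_continuous : forall r, continuous (psys_act r)
}.

Definition is_theta (G : finQuiver) (M : pathSystem G) (t : M) : Prop :=
  [/\ connected_component [set: M] t = [set t], isolated [set: M] t
    & forall m : M, psys_act (psg_zero G) m = t].

(* The objects of P(G)-TOP^o. *)
Record pathTOPo (G : finQuiver) := PathTOPo {
  topo_sys :> pathSystem G;
  topo_full : [set psys_act r m | r in [set: pathSG G] & m in [set: topo_sys]]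
              = [set: topo_sys];
  theta : topo_sys;
  thetaP : unique (@is_theta G topo_sys) theta;
  topo_arrow : forall (i : vertex G) (m : topo_sys),
    psys_act (Some (trivial_path i)) m <> theta ->
    forall a : arrow G, asrc a = i ->
    psys_act (Some (arrow_path a)) m <> theta
}.

Section GradedSystems.
Variables (G : finQuiver) (M : pathTOPo G).

Definition system_graded_over (D : set int) : Prop :=
  exists M_ : int -> set M,
  [/\ forall i, D i -> M_ i !=set0,
      \bigcup_(i in D) M_ i = [set: M],
      forall i j, D i -> D j -> forall r m,
        psg_deg i r -> M_ j m -> M_ (i + j) (psys_act r m)
    & forall i j, D i -> D j -> i <> j -> M_ i `&` M_ j = [set theta M]].

Definition system_graded : Prop := system_graded_over [set: int].
Definition system_positively_graded : Prop := system_graded_over nonneg_int.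

End GradedSystems.

(* Main.v *)
Require Import Defs.
From HB Require Import structures.
From mathcomp Require Import all_boot all_order all_algebra.
From mathcomp Require Import finmap monalg.
From mathcomp Require Import all_classical topology.

(** Both kinds of gradedness are governed by one combinatorial property of the
    quiver: the existence of a height, that is, an integer-valued function on
    the vertices which increases by exactly 1 along every arrow.  The full and
    the positive case are treated at once, by asking that degrees and heights
    lie in a set [D] of integers which contains 0 and is closed under
    successor; the equivalence is then [module_system_graded].

    A height grades everything.  The trivial paths split a module into its
    vertex components [e_v M], and they split a system, away from theta, into
    the disjoint sets of points fixed by one [e_v].  Giving the part at [v]
    the degree [h v] yields a grading, since a path of length [n] raises the
    height by [n] ([module_graded_of_height], [system_graded_of_height]).

    Conversely, one well-chosen object suffices to recover a height: the
    constant representation, with a single point (resp. a line) at every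
    vertex and with every arrow acting as the identity.  In the constant system
    the point at [v] is different from theta, so it lies in only one part of a
    grading, and the arrows carry these points to one another
    ([height_of_system_graded]).  In the constant module the basis vector [u_v]
    is a priori only a sum of homogeneous elements; but [e_v] has degree 0 and
    projects onto the line of [u_v], so it maps some homogeneous summand to a
    nonzero multiple of [u_v], which makes [u_v] itself homogeneous
    ([height_of_module_graded]). *)

Set Implicit Arguments.
Unset Strict Implicit.
Unset Printing Implicit Defensive.

Import Order.TTheory GRing.Theory Num.Theory.
Local Open Scope classical_set_scope.
Local Open Scope ring_scope.

(** * Trivial paths and heights *)

Section PathProducts.
Variable G : finQuiver.
Implicit Types (p q : qpath G) (v w : vertex G).

Lemma trivial_path_mull p :
  ((Some (trivial_path (ptgt p)) : pathSG G) * Some p = Some p)%g.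
Proof.
have e : psrc (trivial_path (ptgt p)) = ptgt p by [].
rewrite [LHS](psg_mul_eq e); congr Some; apply: val_inj => /=.
by rewrite cats0 /psrc /parrows /=; case: (qpath_val p).
Qed.

Lemma trivial_path_mulr p :
  ((Some p : pathSG G) * Some (trivial_path (psrc p)) = Some p)%g.
Proof.
have e : psrc p = ptgt (trivial_path (psrc p)) by [].
rewrite [LHS](psg_mul_eq e); congr Some; apply: val_inj => /=.
by rewrite /psrc /parrows /=; case: (qpath_val p).
Qed.

Lemma trivial_path_mull0 p v : v != ptgt p ->
  ((Some (trivial_path v) : pathSG G) * Some p = psg_zero G)%g.
Proof. exact: (@psg_mul_neq G (trivial_path v)). Qed.

Lemma trivial_path_mulr0 p v : v != psrc p ->
  ((Some p : pathSG G) * Some (trivial_path v) = psg_zero G)%g.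
Proof. by rewrite eq_sym; apply: (@psg_mul_neq G p (trivial_path v)). Qed.

End PathProducts.

Section Height.
Variable G : finQuiver.

Definition height_over (D : set int) (h : vertex G -> int) : Prop :=
  (forall v, D (h v)) /\ forall a, h (atgt a) = h (asrc a) + 1.

(** A path of length [n] raises the height by [n]: this is what makes the height
    compatible with the length grading of paths. *)
Lemma height_path (D : set int) (h : vertex G -> int) (p : qpath G) :
  height_over D h -> h (ptgt p) = h (psrc p) + (plen p)%:Z.
Proof.
move=> [_ hS]; rewrite /ptgt /plen /psrc /parrows.
have := valP p; case: (val p) => v s /=.
elim: s v => [|a s IHs] v /=; first by rewrite addr0.
case/andP => /eqP <- /IHs; rewrite /chain_end /= => ->.
by rewrite hS -addrA intS.
Qed.

End Height.

(** * Systems *)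

Section HeightToSystems.
Variables (G : finQuiver) (D : set int) (h : vertex G -> int).
Hypotheses (D0 : D 0) (hh : height_over D h).
Variable M : pathTOPo G.
Implicit Types (m : M) (r : pathSG G).

Lemma act_zero m : psys_act (psg_zero G) m = theta M.
Proof. by have [[_ _ H] _] := thetaP M. Qed.

Lemma act_theta r : psys_act r (theta M) = theta M.
Proof. by rewrite -[in LHS](act_zero (theta M)) -psys_actM psg_mulg0 act_zero. Qed.

(** Distinct trivial paths multiply to 0, so a point other than theta is attached
    to at most one vertex; its degree is therefore well defined. *)
Lemma act_trivial_inj (v w : vertex G) m : m <> theta M ->
  psys_act (Some (trivial_path v)) m = m ->
  psys_act (Some (trivial_path w)) m = m -> v = w.
Proof.
move=> mt ev ew; apply: contra_notP mt => /eqP vw.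
by rewrite -ev -ew -psys_actM (@trivial_path_mull0 _ (trivial_path w)) ?act_zero.
Qed.

Lemma system_graded_of_height : system_graded_over M D.
Proof.
exists (fun n => [set m | m = theta M \/
   exists2 v, h v = n & psys_act (Some (trivial_path v)) m = m]); split.
- by move=> i _; exists (theta M); left.
- apply/seteqP; split => // m _.
  (* By fullness m = r m', and then the target of r is the vertex of m. *)
  have : [set: M] m by [].
  rewrite -(topo_full M) => -[[p|] _ [m' _ <-]]; last first.
    by exists 0 => //; left; rewrite act_zero.
  exists (h (ptgt p)); first exact: hh.1.
  right; exists (ptgt p) => //.
  by rewrite -psys_actM trivial_path_mull.
- move=> i j _ _ [p|] m /=; last by rewrite act_zero; left.
  move=> pi [->|[v hv ev]]; first by left; rewrite act_theta.
  have [vp|vp] := eqVneq v (psrc p); last first.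
    by left; rewrite -ev -psys_actM trivial_path_mulr0 ?act_zero.
  right; exists (ptgt p); last by rewrite -psys_actM trivial_path_mull.
  by rewrite (height_path p hh) -vp hv pi addrC.
- move=> i j _ _ ij; apply/seteqP; split => [m [] /=|m /= ->]; last first.
    by split; left.
  move=> [//|[v hv ev]] [//|[w hw ew]].
  apply: contra_notP ij => mt.
  by rewrite -hv -hw (act_trivial_inj mt ev ew).
Qed.

End HeightToSystems.

Section ConstantSystem.
Variable G : finQuiver.

(** The point at a vertex [v] is [Some v], and theta is [None]. *)
Definition constant_carrier : Type := discrete_topology (option (vertex G)).
HB.instance Definition _ := DiscreteTopology.on constant_carrier.

Definition constant_act (r : pathSG G) (m : constant_carrier) :
    constant_carrier :=
  match r, m with
  | Some p, Some v => if psrc p == v then Some (ptgt p) else None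
  | _, _ => None
  end.

Lemma constant_actM r r' m :
  constant_act (r * r')%g m = constant_act r (constant_act r' m).
Proof.
have act_None s : constant_act s None = None by case: s.
case: r r' m => [p|] [q|] [v|] //; rewrite ?act_None //=.
have [e|ne] := eqVneq (psrc p) (ptgt q).
  rewrite [(_ * _)%g](psg_mul_eq e) /= ptgt_pcat.
  by case: (psrc q == v); rewrite //= e eqxx.
rewrite [(_ * _)%g](psg_mul_neq ne) /=.
by case: (psrc q == v); rewrite //= (negbTE ne).
Qed.

Lemma constant_act_continuous r : continuous (constant_act r).
Proof.
move=> m U /nbhs_singleton Um.
by apply: (@filterS _ (nbhs m) _ [set m]) => [_ -> //|]; apply: discrete_set1.
Qed.

Definition constant_pathSystem : pathSystem G :=
  @PathSystem G constant_carrier constant_act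
    (ex_intro _ (None : constant_carrier) I)
    constant_actM constant_act_continuous.

(** Uniqueness holds because 0 sends every point to theta, and theta is a component
    because the topology is discrete. *)
Lemma constant_theta :
  unique (@is_theta G constant_pathSystem) (None : constant_carrier).
Proof.
split; last by move=> t [_ _ /(_ None)].
split.
- exact: (zero_dimension_totally_disconnected
    (@discrete_zero_dimension constant_carrier)).
- split; first by rewrite inE.
  exists [set None : constant_carrier]; first exact: discrete_set1.
  by rewrite setIT.
- by [].
Qed.

Lemma constant_full :
  [set psys_act r m | r in [set: pathSG G] & m in [set: constant_pathSystem]]
  = [set: constant_pathSystem].
Proof.
apply/seteqP; split => // -[v|] _.
  exists (Some (trivial_path v)) => //; exists (Some v : constant_carrier) => //=.
  by rewrite eqxx.
by exists None => //; exists None.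
Qed.

Lemma constant_arrow (i : vertex G) (m : constant_pathSystem) :
  psys_act (Some (trivial_path i)) m <> (None : constant_carrier) ->
  forall a : arrow G, asrc a = i ->
  psys_act (Some (arrow_path a)) m <> (None : constant_carrier).
Proof. by case: m => [v|] //= iv a ai; rewrite /psrc /= ai; case: eqP iv. Qed.

Definition constant_system : pathTOPo G :=
  @PathTOPo G constant_pathSystem constant_full None constant_theta
    constant_arrow.

(** The height of [v] is the degree of the point at [v].  An arrow from [v] to
    [w] moves the point at [v] to the point at [w], which then lies both in its
    own degree and in the degree of [v] plus 1; as it is not theta, the two
    degrees agree. *)
Lemma height_of_system_graded (D : set int) :
  D 0 -> (forall n, D n -> D (n + 1)) ->
  system_graded_over constant_system D -> exists h, @height_over G D h.
Proof.
move=> D0 DS [M_ [_ Mcover Mact Mdisj]].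
have hP (v : vertex G) : exists n, D n /\ M_ n (Some v : constant_carrier).
  have : [set: constant_system] (Some v : constant_carrier) by [].
  by rewrite -Mcover => -[n Dn Mn]; exists n.
pose h v := projT1 (cid (hP v)).
have hD v : D (h v) by rewrite /h; case: cid => n [].
have hM v : M_ (h v) (Some v : constant_carrier) by rewrite /h; case: cid => n [].
have D1 : D 1 by rewrite -[1]add0r; apply: DS.
exists h; split=> // a; apply: contrapT => hne.
have Ma : M_ (1 + h (asrc a)) (Some (atgt a) : constant_carrier).
  have -> : (Some (atgt a) : constant_carrier) =
      constant_act (Some (arrow_path a)) (Some (asrc a)) by rewrite /= eqxx.
  exact: Mact.
rewrite addrC in Ma.
have : (M_ (h (atgt a)) `&` M_ (h (asrc a) + 1))
    (Some (atgt a) : constant_carrier).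
  by split.
by rewrite Mdisj //; apply: DS.
Qed.

End ConstantSystem.

(** * Scalars and basis elements of the path algebra *)

Section PathAlgebraFacts.
Variables (k : fieldType) (G : finQuiver).
Implicit Types (x : pathAlg k G) (p q : qpath G).

Lemma pbasis_mul p q :
  pbasis k p * pbasis k q = psg_embed k ((Some p : pathSG G) * Some q)%g.
Proof. exact: pa_mul_basis. Qed.

Lemma scalar_mul (c : k) x :
  c *: x = (c *: (1 : pathAlg k G)) * x.
Proof. by rewrite -[in LHS](mul1r x); apply: pa_scalerAl. Qed.

(** The field sits in the centre of the path algebra, so the action of a scalar on
    a module preserves every vertex component. *)
Lemma scalar_comm (c : k) x :
  x * (c *: (1 : pathAlg k G)) = (c *: (1 : pathAlg k G)) * x.
Proof.
rewrite -scalar_mul -[in RHS](mulr1 x); symmetry; exact: pa_scalerAr.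
Qed.

Lemma pathAlg_deg_pbasis p : pathAlg_deg (plen p)%:Z (pbasis k p).
Proof.
exists [:: p], (fun=> 1); split=> [q|]; first by rewrite inE => /eqP ->.
by rewrite big_seq1 scale1r.
Qed.

End PathAlgebraFacts.

(** * From a height to gradings of modules *)

Section HeightToModules.
Variables (k : fieldType) (G : finQuiver) (D : set int) (h : vertex G -> int).
Hypothesis hh : height_over D h.
Variable M : lmodType (pathAlg k G).
Implicit Types (m : M) (v : vertex G).

Let e v : pathAlg k G := pbasis k (trivial_path v).

Lemma sum_vertex_component m : m = \sum_v e v *: m.
Proof. by rewrite -scaler_suml scale1r. Qed.

(** This is the sum of the components [e_v M] over the vertices of height [n],
    written by the vanishing of the other components so that closure properties
    and independence can be checked one vertex at a time. *)
Let height_comp n : set M := [set m | forall v, h v <> n -> e v *: m = 0].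

Lemma comp_subspace n : k_subspace (height_comp n).
Proof.
split=> [v _|m m' Mm Mm' v hv|c m Mm v hv]; first exact: scaler0.
  by rewrite scalerDr Mm ?Mm' ?addr0.
by rewrite scalerA scalar_comm -scalerA Mm // scaler0.
Qed.

Lemma comp_vertex v m : height_comp (h v) (e v *: m).
Proof.
move=> w wv; rewrite scalerA pbasis_mul (@trivial_path_mull0 _ (trivial_path v)).
  by rewrite scale0r.
by apply/eqP => ewv; apply: wv; rewrite ewv.
Qed.

Lemma comp_sum (I : Type) (s : seq I) (P : pred I) (f : I -> M) n :
  (forall i, P i -> height_comp n (f i)) ->
  height_comp n (\sum_(i <- s | P i) f i).
Proof.
have [M0 MD _] := comp_subspace n.
by move=> Mf; apply: big_ind.
Qed.

Lemma comp_decomposition : direct_sum_decomposition D height_comp.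
Proof.
split=> [m|s f sf f0 n ns].
  exists [fset h v | v in vertex G]%fset, (fun n => \sum_(v | h v == n) e v *: m).
  split=> [_ /imfsetP[v _ ->]|].
    split; first exact: hh.1.
    by apply: comp_sum => w /eqP <-; apply: comp_vertex.
  rewrite [LHS]sum_vertex_component.
  (* Each vertex contributes to exactly one degree, namely its height. *)
  rewrite (exchange_big_dep xpredT) //=; apply: eq_bigr => v _.
  rewrite -big_filter (_ : [seq _ <- _ | _] = [:: h v]) ?big_seq1 //.
  have hv : h v \in [fset h v | v in vertex G]%fset by apply: in_imfset.
  rewrite (eq_filter (a2 := pred1 (h v))); last by move=> n; rewrite /= eq_sym.
  by rewrite filter_pred1_uniq ?fset_uniq.
rewrite [LHS]sum_vertex_component big1 // => v _.
have [hv|/eqP hv] := eqVneq (h v) n; last by have [_ ->] := sf _ ns.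
(* If v has height n, then e_v kills the summands of degree other than n. *)
have : e v *: \sum_(i <- s) f i = 0 by rewrite f0 scaler0.
rewrite scaler_sumr (big_fsetD1 n) //= big_seq big1 ?addr0 // => i.
rewrite !inE => /andP[ni si]; have [_ ->//] := sf _ si.
by rewrite hv; apply/eqP; rewrite eq_sym.
Qed.

(** Since [p = p e_s] with [s] the source of [p], the product [p m] vanishes unless
    [s] has height [n]; and it lies in the component at the target of [p]. *)
Lemma comp_path (p : qpath G) n m :
  height_comp n m -> height_comp ((plen p)%:Z + n) (pbasis k p *: m).
Proof.
move=> Mm v hv; rewrite scalerA pbasis_mul.
have [vp|vp] := eqVneq v (ptgt p); last first.
  by rewrite trivial_path_mull0 // scale0r.
rewrite vp trivial_path_mull -(trivial_path_mulr p) -pbasis_mul -scalerA.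
rewrite Mm ?scaler0 // => hp; apply: hv.
by rewrite vp (height_path p hh) hp addrC.
Qed.

Lemma module_graded_of_height : module_graded_over M D.
Proof.
exists height_comp; split; first by move=> *; apply: comp_subspace.
  exact: comp_decomposition.
move=> i j _ _ x m [s [c [sp ->]]] Mm.
rewrite scaler_suml big_seq; apply: comp_sum => p /sp <-.
have [_ _ MZ] := comp_subspace ((plen p)%:Z + j).
by rewrite scalar_mul -scalerA; apply/MZ/comp_path.
Qed.

End HeightToModules.

(** * The constant module *)

Section ConstantModule.
Variables (k : fieldType) (G : finQuiver).

Local Notation V := {ffun vertex G -> k^o}.
Implicit Types (f g : V) (x y : pathAlg k G) (p q : qpath G) (v : vertex G).

Definition path_op p f : V :=
  [ffun j => if j == ptgt p then f (psrc p) else 0].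

Definition pa_act x f : V :=
  \sum_(p <- msupp x) x@_p *: path_op p f.

Lemma path_opD p : {morph path_op p : f g / f + g}.
Proof. by move=> f g; apply/ffunP => j; rewrite !ffunE; case: ifP; rewrite ?addr0. Qed.

Lemma path_opZ p (c : k) f : path_op p (c *: f) = c *: path_op p f.
Proof. by apply/ffunP => j; rewrite !ffunE; case: ifP; rewrite ?scaler0. Qed.

(** The support of a sum or a multiple may shrink, so additivity in [x] needs
    sums over a common larger finite set. *)
Lemma pa_actw (d : {fset qpath G}) x f : (msupp x `<=` d)%fset ->
  pa_act x f = \sum_(p <- d) x@_p *: path_op p f.
Proof.
move=> le; rewrite /pa_act (big_fset_incl _ le) //= => p _ /mcoeff_outdom ->.
by rewrite scale0r.
Qed.

Lemma pa_actDl f : {morph pa_act^~ f : x y / x + y}.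
Proof.
move=> x y; rewrite (pa_actw f (msuppD_le x y)).
rewrite (pa_actw f (fsubsetUl (msupp x) (msupp y))).
rewrite (pa_actw f (fsubsetUr (msupp x) (msupp y))) -big_split /=.
by apply: eq_bigr => p _; rewrite mcoeffD scalerDl.
Qed.

Lemma pa_actDr : right_distributive pa_act +%R.
Proof.
move=> x f g; rewrite /pa_act -big_split /=.
by apply: eq_bigr => p _; rewrite path_opD scalerDr.
Qed.

Lemma pa_actZl (c : k) x f : pa_act (c *: x) f = c *: pa_act x f.
Proof.
rewrite (pa_actw f (msuppZ_le c x)) scaler_sumr.
by apply: eq_bigr => p _; rewrite mcoeffZ scalerA.
Qed.

Lemma pa_actZr (c : k) x f : pa_act x (c *: f) = c *: pa_act x f.
Proof.
rewrite /pa_act scaler_sumr; apply: eq_bigr => p _.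
by rewrite path_opZ !scalerA mulrC.
Qed.

Lemma pa_act0l f : pa_act 0 f = 0.
Proof. by rewrite /pa_act msupp0 big_seq_fset0. Qed.

Lemma pa_act0r x : pa_act x 0 = 0.
Proof. by rewrite -(scale0r 0) pa_actZr !scale0r. Qed.

Lemma pa_act_basis p f : pa_act (pbasis k p) f = path_op p f.
Proof.
by rewrite (pa_actw f msuppU_le) big_seq_fset1 mcoeffUU scale1r.
Qed.

Lemma pa_actA x y f : pa_act x (pa_act y f) = pa_act (x * y) f.
Proof.
move: x; apply: (@pbasis_ind k G) => [|x x' Hx Hx'|c x Hx|p].
- by rewrite mul0r !pa_act0l.
- by rewrite mulrDl !pa_actDl Hx Hx'.
- by rewrite -[c *: x * y]pa_scalerAl !pa_actZl Hx.
move: y; apply: (@pbasis_ind k G) => [|y y' Hy Hy'|c y Hy|q].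
- by rewrite mulr0 pa_act0l pa_act0r.
- by rewrite mulrDr !pa_actDl pa_actDr Hy Hy'.
- by rewrite -[_ * (c *: y)]pa_scalerAr !pa_actZl pa_actZr Hy.
rewrite pbasis_mul !pa_act_basis; apply/ffunP => j.
have [epq|npq] := eqVneq (psrc p) (ptgt q).
  by rewrite [(_ * _)%g](psg_mul_eq epq) /= pa_act_basis !ffunE ptgt_pcat epq eqxx.
rewrite [(_ * _)%g](psg_mul_neq npq) /= pa_act0l !ffunE (negbTE npq).
by case: ifP.
Qed.

Lemma pa_act1 : left_id 1 pa_act.
Proof.
move=> f; rewrite (big_morph _ (pa_actDl f) (pa_act0l f)).
apply/ffunP => j; rewrite sum_ffunE (bigD1 j) //= pa_act_basis ffunE eqxx.
rewrite big1 ?addr0 // => i ij; rewrite pa_act_basis ffunE.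
by rewrite eq_sym (negbTE ij).
Qed.

(** A separate name, because the functions on the vertices are already a module
    over [k] itself. *)
Definition constant_module : Type := V.
HB.instance Definition _ := GRing.Zmodule.on constant_module.
HB.instance Definition _ := GRing.Zmodule_isLmodule.Build (pathAlg k G)
  constant_module pa_actA pa_act1 pa_actDr pa_actDl.

Definition vertex_unit v : constant_module := [ffun j => (j == v)%:R : k^o].
Local Notation u := vertex_unit.

Lemma path_unit p : pbasis k p *: u (psrc p) = u (ptgt p).
Proof.
apply: etrans (pa_act_basis p _) _; apply/ffunP => j.
by rewrite !ffunE eqxx; case: ifP.
Qed.

(** The projection onto the line of [u v], with its coefficient written as [c *: 1]
    because homogeneous parts are closed under scalars in that form. *)
Lemma trivial_path_scale v (f : constant_module) :
  pbasis k (trivial_path v) *: f = ((f v : k) *: (1 : pathAlg k G)) *: u v.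
Proof.
apply: etrans (pa_act_basis _ f) _; symmetry.
apply: etrans (pa_actZl (f v) 1 (u v)) _; rewrite pa_act1.
apply/ffunP => j; rewrite !ffunE /=.
by case: (j == v); rewrite ?scaler0 //; apply: mulr1.
Qed.

Lemma unit_neq0 v : u v != 0.
Proof.
apply/eqP => /ffunP /(_ v); rewrite !ffunE eqxx => /eqP.
by rewrite (oner_eq0 k).
Qed.

End ConstantModule.

(** * From gradings of modules to a height *)

(** Otherwise [m] in degree [i] and [- m] in degree [j] would be a nontrivial
    relation. *)
Lemma direct_sum_degree_inj (k : fieldType) (G : finQuiver)
    (M : lmodType (pathAlg k G)) (D : set int) (M_ : int -> set M)
    (i j : int) (m : M) :
  (forall n, D n -> k_subspace (M_ n)) -> direct_sum_decomposition D M_ ->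
  D i -> D j -> M_ i m -> M_ j m -> m != 0 -> i = j.
Proof.
move=> Msub [_ Mind] Di Dj Mi Mj; apply: contraNeq => ij.
have MjN : M_ j (- m).
  have [_ _ MZ] := Msub j Dj.
  by have := MZ (-1) m Mj; rewrite !scaleN1r.
pose f n := if n == i then m else - m.
have sf n : n \in [fset i; j]%fset -> D n /\ M_ n (f n).
  rewrite !inE /f => /orP[] /eqP ->; first by rewrite eqxx.
  by rewrite eq_sym (negbTE ij).
have := Mind _ f sf; rewrite big_fsetU1 ?inE //= big_seq_fset1.
rewrite /f eqxx eq_sym (negbTE ij) subrr => /(_ erefl i).
by rewrite !inE eqxx => /(_ isT) ->.
Qed.

Section ModulesToHeight.
Variables (k : fieldType) (G : finQuiver) (D : set int).
Hypotheses (D0 : D 0) (DS : forall n, D n -> D (n + 1)).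

(** Write [u v] for the basis vector at [v].  It is homogeneous, because the
    degree 0 projection [e_v] onto its line maps some homogeneous summand of [u v] to a nonzero multiple of it.  The
    height of [v] is the degree of [u v], and an arrow from [v] to [w] maps
    [u v] to [u w]. *)
Lemma height_of_module_graded :
  module_graded_over (constant_module k G) D -> exists h, @height_over G D h.
Proof.
move=> [M_ [Msub Mdec Mact]].
pose u := @vertex_unit k G.
have hP v : exists n, D n /\ M_ n (u v).
  have [s [f [sf uE]]] := Mdec.1 (u v).
  have uvE : u v = \sum_(n <- s) pbasis k (trivial_path v) *: f n.
    by rewrite -scaler_sumr -uE [RHS](path_unit k (trivial_path v)).
  have [n [ns fn0]] : exists n, n \in s /\ (f n : {ffun _ -> k^o}) v != 0.
    apply: contrapT => fn0; have /eqP := unit_neq0 k v; apply.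
    rewrite [LHS]uvE big_seq big1 // => n ns; rewrite trivial_path_scale.
    have [->|fnv] := eqVneq ((f n : {ffun _ -> k^o}) v) 0.
      by rewrite scale0r scale0r.
    by case: fn0; exists n.
  have [Dn Mn] := sf n ns; exists n; split => //.
  (* The coefficient of u v in the summand is nonzero; divide by it. *)
  have := Mact 0 n D0 Dn _ _ (pathAlg_deg_pbasis k (trivial_path v)) Mn.
  rewrite add0r trivial_path_scale => Mcu.
  have [_ _ MZ] := Msub n Dn.
  have := MZ ((f n : {ffun _ -> k^o}) v)^-1 _ Mcu.
  by rewrite scalerA -scalar_mul scalerA mulVf // scale1r scale1r.
pose h v := projT1 (cid (hP v)).
have hD v : D (h v) by rewrite /h; case: cid => n [].
have hM v : M_ (h v) (u v) by rewrite /h; case: cid => n [].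
have D1 : D 1 by rewrite -[1]add0r; apply: DS.
exists h; split=> // a.
have := Mact 1 _ D1 (hD _) _ _ (pathAlg_deg_pbasis k (arrow_path a)) (hM (asrc a)).
rewrite [pbasis _ _ *: _](path_unit k (arrow_path a)) addrC => Ma.
apply: (direct_sum_degree_inj Msub Mdec) (hM _) Ma (unit_neq0 k _) => //.
exact: DS.
Qed.

End ModulesToHeight.

Lemma module_system_graded (k : fieldType) (G : finQuiver) (D : set int) :
  D 0 -> (forall n, D n -> D (n + 1)) ->
  (forall M : lmodType (pathAlg k G), module_graded_over M D) <->
  (forall M : pathTOPo G, system_graded_over M D).
Proof.
move=> D0 DS; split=> HM M.
  have [h hh] := height_of_module_graded D0 DS (HM (constant_module k G)).
  exact: system_graded_of_height hh M.
have [h hh] := height_of_system_graded D0 DS (HM (constant_system G)).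
exact: module_graded_of_height hh M.
Qed.

Theorem corollary3p9 (G : finQuiver) (k : fieldType)
  (G_connected : connected_quiver G) :
  ((forall M : lmodType (pathAlg k G), module_graded M) <->
   (forall M : pathTOPo G, system_graded M))
  /\
  ((forall M : lmodType (pathAlg k G), module_positively_graded M) <->
   (forall M : pathTOPo G, system_positively_graded M)).
Proof.
split; first exact: module_system_graded.
by apply: module_system_graded => // n n0; apply: addr_ge0.
Qed.
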